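(* Let $\mathbb{H}$ be a uniform $\mathcal{L}_{\mathbb{H}}$-layered semifield and let $\mathbb{D}$ be a uniform $\mathcal{L}_{\mathbb{D}}$-layered domain extending $\mathbb{H}$. Let $a \in \mathbb{D}$. Then the uniform closure $\mathscr{U}_{\mathbb{D}}(\mathbb{H}[a])$ exists, and $$\mathscr{U}_{\mathbb{D}}(\mathbb{H}[a]) = (\mathbb{H}[s(a) \odot 1])[1 \odot \nu(a)] = (\mathbb{H}[1 \odot \nu(a)])[s(a) \odot 1] = \mathbb{H}[s(a)] \cdot \mathbb{H}[\nu(a)]$$ $$= \{ (p(s(a)) \odot \alpha) \cdot (s \odot \nu(q(\nu(a)))) \ : \ p \in \mathcal{L}_{\mathbb{H}}[x],\ q \in \mathbb{H}[x],\ \alpha \in \mathcal{G}(\mathbb{H}),\ s \in \mathcal{L}_{\mathbb{H}} \} = \mathcal{L}_{\mathbb{H}}[s(a)] \odot \mathcal{G}(\mathbb{H}[\nu(a)]).$$ This is the smallest uniform layered domain (inside $\mathbb{D}$) extending $\mathbb{H}$ and containing $a$.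
   Context: A uniform $\mathcal{L}$-layered domain is a set of pairs $\mathbb{D} = \{ {}^{[l]}a : l \in \mathcal{L},\ a \in \mathcal{G}\}$, where $\mathcal{G}$ (the semiring of values, written $\mathcal{G}(\mathbb{D})$) is an ordered semiring whose addition is the maximum and which is a domain (i.e. multiplicatively cancellative), and $\mathcal{L}$ (the sorting semiring, written $\mathcal{L}_{\mathbb{D}}$) is a partially pre-ordered commutative semiring without zero, assumed additively cancellative. Multiplication is ${}^{[k]}a \cdot {}^{[l]}b = {}^{[kl]}ab$; addition is ${}^{[k]}a + {}^{[l]}b = {}^{[k]}a$ if $a>b$, ${}^{[l]}b$ if $a<b$, and ${}^{[k+l]}b$ if $a=b$. One also writes $\mathbb{D} = \mathcal{L}\odot\mathcal{G}$ and ${}^{[l]}a = l \odot a$. The sorting map is $s({}^{[l]}a)=l$ and the ghost (value) map is $\nu({}^{[l]}a)=a$; for a subset $E$ of a layered domain, $\mathcal{G}(E)=\nu(E)$. A uniform layered semifield is a uniform layered domain $\mathcal{L}\odot\mathcal{G}$ that is a semifield; equivalently, $\mathcal{L}$ and $\mathcal{G}$ are both semifields. If $\mathbb{D}$ extends $\mathbb{H}$ (as a layered domain) then $\mathcal{L}_{\mathbb{H}}\subseteq\mathcal{L}_{\mathbb{D}}$ and $\mathcal{G}(\mathbb{H})\subseteq\mathcal{G}(\mathbb{D})$. A uniform sub-domain of $\mathbb{D}$ is a domain of the form $\mathcal{L}'\odot\mathcal{G}'$ with $\mathcal{L}'\subseteq\mathcal{L}_{\mathbb{D}}$, $\mathcal{G}'\subseteq\mathcal{G}(\mathbb{D})$.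 For $a\in\mathbb{D}$: $\mathbb{H}[a]=\{f(a) : f\in\mathbb{H}[x]\}$, where $\mathbb{H}[x]$ is the polynomial semiring over $\mathbb{H}$ (the same notation $\mathbb{K}[a]$ is used for any layered subdomain $\mathbb{K}$ in place of $\mathbb{H}$); $\mathcal{L}_{\mathbb{H}}[s(a)] = \{g(s(a)) : g\in\mathcal{L}_{\mathbb{H}}[x]\}$. Polynomials over a semiring without zero are finite nonempty formal sums of monomials. The elements $s(a)\odot 1$ and $1\odot\nu(a)$ of $\mathbb{D}$ are abbreviated $s(a)$ and $\nu(a)$, so $\mathbb{H}[s(a)]=\mathbb{H}[s(a)\odot 1]$ and $\mathbb{H}[\nu(a)]=\mathbb{H}[1\odot\nu(a)]$. For subsets $X,Y$ of $\mathbb{D}$, $X\cdot Y=\{xy: x\in X, y\in Y\}$. For $E\subset\mathbb{D}$, the uniform closure $\mathscr{U}_{\mathbb{D}}(E)$ is the minimal (with respect to inclusion) uniform layered domain $\mathbb{E}$ with $E\subseteq\mathbb{E}\subseteq\mathbb{D}$, if it exists. *)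

(* Defs.v *)
From HB Require Import structures.
From mathcomp Require Import all_boot all_order.
From mathcomp Require Import finmap.
From mathcomp Require Import classical_sets.

Set Implicit Arguments.
Unset Strict Implicit.
Unset Printing Implicit Defensive.

Import Order.TTheory.

Local Open Scope classical_set_scope.
Local Open Scope ring_scope.
Local Open Scope group_scope.

(* Commutative semirings with 1 whose signature has no zero: the additive part
   is a commutative semigroup, hence the use of the multiplicative notation of
   monoids (1, *, ^+ in group_scope) next to + (in ring_scope). *)
HB.mixin Record isZFComSemiring R of Algebra.AddSemigroup R & Monoid R := {
  zfmulC : commutative (@monoid.mul R);
  zfmulDl : left_distributive (@monoid.mul R) (@Algebra.add R)
}.

#[short(type="zfComSemiringType")]
HB.structure Definition ZFComSemiring :=
  {R of isZFComSemiring R & Algebra.AddSemigroup R & Monoid R}.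

HB.mixin Record isPreorderedSemiring (d : Order.disp_t) R
    of ZFComSemiring R & Order.Preorder d R := {
  zfleD2r : forall z x y : R, (x <= y)%O -> (x + z <= y + z)%O;
  zfleM2r : forall z x y : R, (x <= y)%O -> (x * z <= y * z)%O
}.

#[short(type="preorderedSemiringType")]
HB.structure Definition PreorderedSemiring (d : Order.disp_t) :=
  {R of isPreorderedSemiring d R & ZFComSemiring R & Order.Preorder d R}.

HB.mixin Record isSortingSemiring (d : Order.disp_t) L
    of PreorderedSemiring d L := {
  sort_addIr : forall z x y : L, x + z = y + z -> x = y
}.

#[short(type="sortingSemiringType")]
HB.structure Definition SortingSemiring (d : Order.disp_t) :=
  {L of isSortingSemiring d L & PreorderedSemiring d L}.

HB.mixin Record isValueSemiring (d : Order.disp_t) G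
    of PreorderedSemiring d G & Order.Total d G := {
  value_addE : forall x y : G, x + y = Order.max x y;
  value_mulIg : forall z x y : G, x * z = y * z -> x = y
}.

#[short(type="valueSemiringType")]
HB.structure Definition ValueSemiring (d : Order.disp_t) :=
  {G of isValueSemiring d G & PreorderedSemiring d G & Order.Total d G}.

Section ValueOrder.
Context (d : Order.disp_t) (G : valueSemiringType d).
Implicit Types a b c : G.

Lemma value_ltM2r c a b : (a * c < b * c)%O = (a < b)%O.
Proof.
apply/idP/idP => [|ab]; first by apply: contraTT; rewrite -!leNgt; exact: zfleM2r.
rewrite lt_neqAle (zfleM2r c _ _ (ltW ab)) andbT.
by apply: contra_ltN ab => /eqP /value_mulIg ->.
Qed.

End ValueOrder.

Record layered (L G : Type) := Layer { sorting : L; value : G }.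

Notation "l ⊙ a" := (Layer l a) (at level 41, no associativity).

Section LayeredChoice.
Context (L G : choiceType).

Definition pair_of_layered (x : layered L G) := (sorting x, value x).
Definition layered_of_pair (x : L * G) := x.1 ⊙ x.2.

Lemma pair_of_layeredK : cancel pair_of_layered layered_of_pair.
Proof. by case. Qed.

HB.instance Definition _ :=
  Choice.copy (layered L G) (can_type pair_of_layeredK).

End LayeredChoice.

Section Layered.
Context (d d' : Order.disp_t) (L : sortingSemiringType d)
  (G : valueSemiringType d').
Implicit Types x y z : layered L G.

Definition layered_add x y :=
  if (value y < value x)%O then x
  else if (value x < value y)%O then y
  else (sorting x + sorting y) ⊙ value y.

Definition layered_mul x y := (sorting x * sorting y) ⊙ (value x * value y).

Definition layered_one : layered L G := 1 ⊙ 1.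

Lemma layered_addC : commutative layered_add.
Proof.
move=> [k a] [l b]; rewrite /layered_add /=.
by case: ltgtP => // ->; rewrite Algebra.addrC.
Qed.

Lemma layered_addA : associative layered_add.
Proof.
move=> [k a] [l b] [m c]; rewrite /layered_add /=.
case: (ltgtP b c) => /= [bc|cb|<-{c}]; case: (ltgtP a b) => /= [ab|ba|ab];
  rewrite ?ltxx ?ab ?ba ?bc ?cb //=.
- have ac := lt_trans ab bc.
  by rewrite ac (lt_gtF ac) (lt_gtF bc).
- by rewrite (lt_gtF bc).
- by rewrite (lt_trans cb ba).
- by rewrite Algebra.addrA.
Qed.

Lemma layered_mulA : associative layered_mul.
Proof. by move=> [k a] [l b] [m c]; rewrite /layered_mul /= !mulgA. Qed.

Lemma layered_mul1 : left_id layered_one layered_mul.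
Proof. by move=> [k a]; rewrite /layered_mul /= !mul1g. Qed.

Lemma layered_mulC : commutative layered_mul.
Proof.
by move=> [k a] [l b]; rewrite /layered_mul /= (zfmulC k) (zfmulC a).
Qed.

Lemma layered_mulr1 : right_id layered_one layered_mul.
Proof. by move=> x; rewrite layered_mulC layered_mul1. Qed.

Lemma layered_mulDl : left_distributive layered_mul layered_add.
Proof.
move=> [k a] [l b] [m c]; rewrite /layered_mul /layered_add /= !value_ltM2r.
by case: ltgtP => //= _; rewrite zfmulDl.
Qed.

HB.instance Definition _ :=
  Algebra.isAddSemigroup.Build (layered L G) layered_addC layered_addA.
HB.instance Definition _ :=
  isMonoid.Build (layered L G) layered_mulA layered_mul1 layered_mulr1.
HB.instance Definition _ :=
  isZFComSemiring.Build (layered L G) layered_mulC layered_mulDl.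

End Layered.

(* A polynomial over a semiring without zero: a nonempty finite partial map from
   exponents to coefficients. *)
Record zfpoly (R : Type) := ZFPoly {
  coefs : {fmap nat -> R};
  coefs_neq0 : domf coefs != fset0
}.

Definition zfpoly_over (R : Type) (K : set R) : set (zfpoly R) :=
  [set p : zfpoly R | forall i : domf (coefs p), K (coefs p i)].

Section Evaluation.
Context (R : zfComSemiringType).
Implicit Types (p : zfpoly R) (a : R) (K : set R).

Definition opeval p a : option R :=
  \big[oAC (@Algebra.addrA R) (@Algebra.addrC R)/None]_(i : domf (coefs p))
    Some (coefs p i * a ^+ val i).

(* The default 1 is never used, see Some_peval. *)
Definition peval p a : R := odflt 1 (opeval p a).

Lemma Some_peval p a : Some (peval p a) = opeval p a.
Proof.
rewrite /peval; suff: opeval p a != None by case: (opeval p a).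
have /fset0Pn[i ip] := coefs_neq0 p.
by rewrite /opeval (bigD1 [` ip]%fset) //=; case: (\big[_/_]_(_ | _) _).
Qed.

(* K[a], for K a subset of R. *)
Definition adjoin K a : set R := [set peval p a | p in zfpoly_over K].

Definition subsemiring K :=
  [/\ K 1, forall x y, K x -> K y -> K (x + y)
    & forall x y, K x -> K y -> K (x * y)].

Definition subsemifield K :=
  subsemiring K /\ forall x, K x -> exists2 y, K y & x * y = 1.

End Evaluation.

Section UniformSubdomains.
Context (d d' : Order.disp_t) (L : sortingSemiringType d)
  (G : valueSemiringType d').
Implicit Types (A : set L) (B : set G) (E U V : set (layered L G)).

Definition layered_set A B : set (layered L G) :=
  [set l ⊙ a | l in A & a in B].

(* Cancellation laws and (pre)orders are inherited by A and B from L and G. *)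
Definition uniform_subdomain E :=
  exists A B, [/\ subsemiring A, subsemiring B & E = layered_set A B].

(* layered_set A B is a uniform layered semifield, with sorting semiring A and
   semiring of values B. *)
Definition uniform_semifield A B :=
  [/\ subsemiring A, subsemiring B & subsemifield (layered_set A B)].

Definition least (P : set (set (layered L G))) U :=
  P U /\ forall V, P V -> U `<=` V.

Definition is_uniform_closure E U :=
  least [set V | uniform_subdomain V /\ E `<=` V] U.

End UniformSubdomains.

(* Main.v *)
Require Import Defs.
From mathcomp Require Import all_boot all_order.
From mathcomp Require Import finmap.
From mathcomp Require Import classical_sets.

Set Implicit Arguments.
Unset Strict Implicit.
Unset Printing Implicit Defensive.

Import Order.TTheory.

Local Open Scope classical_set_scope.
Local Open Scope ring_scope.
Local Open Scope group_scope.

(** Adjoining an element to a subsemiring [K] gives the least subsemiring that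
    contains [K] and this element; concretely, [adjoin K a] is the additive
    closure of the monomials [k * a ^+ i]. So it suffices to understand
    adjunction along the two axes of a layered domain.

    Adjoining [s ⊙ 1] to [A ⊙ B] changes only the layers: a sum of monomials in
    [A[s]] is realized by giving all of them the same value, since elements of
    equal value add their layers ([adjoin_sorting]). Adjoining [1 ⊙ v] changes
    only the values: as addition of values is the maximum, a sum of values is one
    of its terms, so that no layers ever have to be added ([adjoin_value]).

    Applied in either order to [LH ⊙ GH], these two facts turn all the sets of
    the theorem into [LH[sorting a] ⊙ GH[value a]]. This set is a uniform
    domain that contains [H] and [a]; conversely, if [A' ⊙ B'] contains them,
    then [A'] contains [LH] and [sorting a], and [B'] contains [GH] and
    [value a] ([least_extension]). Finally a uniform domain, being a
    subsemiring, contains [H] and [a] iff it contains [H[a]]. *)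

(** * Adjunction of an element to a subsemiring *)

Section Adjoin.
Context (R : zfComSemiringType).
Implicit Types (p : zfpoly R) (a k x y z : R) (K V : set R).

Local Notation oadd := (oAC (@Algebra.addrA R) (@Algebra.addrC R)).

Definition oterm p a (j : nat) : option R :=
  omap (fun k => k * a ^+ j) (coefs p).[? j]%fmap.

(** Extracting the term of exponent [i] makes sense even when [i] is not an
    exponent of [p]: the term is then [None], the neutral element. This avoids
    a case analysis when a coefficient is updated. *)
Lemma opevalD1 p a i :
  opeval p a =
    oadd (oterm p a i)
      (\big[oadd/None]_(j <- (domf (coefs p) `\ i)%fset) oterm p a j).
Proof.
have -> : opeval p a = \big[oadd/None]_(j <- domf (coefs p)) oterm p a j.
  rewrite /opeval [RHS]big_seq_fsetE /=; apply: eq_bigr => j _.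
  by rewrite /oterm -Some_fnd.
have [ip|ip] := boolP (i \in domf (coefs p)); first by rewrite (big_fsetD1 i).
have -> : oterm p a i = None by rewrite /oterm not_fnd.
by rewrite mem_fsetD1 // [RHS]Monoid.mul1m.
Qed.

Lemma setf_neq0 (f : {fmap nat -> R}) i k : domf (f.[i <- k]%fmap) != fset0%fset.
Proof. by apply/fset0Pn; exists i; rewrite dom_setf fset1U1. Qed.

Lemma zfpoly_over_setf K (f : {fmap nat -> R}) i k :
    (forall j : domf f, K (f j)) -> K k ->
  zfpoly_over K (ZFPoly (setf_neq0 f i k)).
Proof.
move=> Kf Kk j /=; rewrite ffunE /=; case: eqP => // _.
by case: fndP => //= jf; exact: Kf.
Qed.

(** Each polynomial being a nonempty sum, the elements of [K[a]] are generated
    additively by the monomials, without a zero to start from. *)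
Lemma adjoin_ind K a (P : R -> Prop) :
    (forall k i, K k -> P (k * a ^+ i)) ->
    (forall x y, P x -> P y -> P (x + y)) ->
  forall z, adjoin K a z -> P z.
Proof.
move=> Pmono PD _ [p Kp <-].
pose Q (o : option R) := if o is Some x then P x else True.
suff : Q (opeval p a) by rewrite -Some_peval.
apply: big_ind => //; first by move=> [x|] [y|] //=; exact: PD.
by move=> i _; apply: Pmono; exact: Kp.
Qed.

Lemma adjoin_monomial K a k i : K k -> adjoin K a (k * a ^+ i).
Proof.
move=> Kk; exists (ZFPoly (setf_neq0 [fmap]%fmap i k)).
  by apply: zfpoly_over_setf => // -[].
apply: Some_inj; rewrite Some_peval (opevalD1 _ _ i) /oterm /= fnd_set eqxx /=.
by rewrite fsetU0 fsetDv big_seq_fset0.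
Qed.

Section Subsemiring.
Context (K : set R) (sK : subsemiring K).

Lemma adjoin_addmonomial a x k i :
  adjoin K a x -> K k -> adjoin K a (x + k * a ^+ i).
Proof.
case: sK => _ KD _ [p Kp <-] Kk.
(* The monomial is merged into the coefficient of p with the same exponent. *)
pose k' := oapp (fun c => c + k) k (coefs p).[? i]%fmap.
have Kk' : K k'.
  by rewrite /k'; case: fndP => // ip; apply: KD => //; exact: Kp.
exists (ZFPoly (setf_neq0 (coefs p) i k')); first exact: zfpoly_over_setf.
apply: Some_inj; rewrite Some_peval (opevalD1 _ _ i).
have -> : Some (peval p a + k * a ^+ i)
        = oadd (opeval p a) (Some (k * a ^+ i)) by rewrite -Some_peval.
rewrite (opevalD1 p a i) [RHS]Monoid.mulmAC /=; congr (oadd _ _).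
  rewrite /oterm fnd_set eqxx /k' /=.
  by case: (_.[? i]%fmap) => //= c; rewrite zfmulDl.
rewrite /= fsetDUl fsetDv fset0U.
apply: eq_big_seq => j; rewrite !inE => /andP[ji _].
by rewrite /oterm fnd_set (negbTE ji).
Qed.

Lemma zfmulDr : right_distributive (@monoid.mul R) (@Algebra.add R).
Proof. by move=> x y z; rewrite !(zfmulC x) zfmulDl. Qed.

Lemma adjoin_subsemiring a : subsemiring (adjoin K a).
Proof.
have [K1 _ KM] := sK.
have addK x y : adjoin K a x -> adjoin K a y -> adjoin K a (x + y).
  move=> ax ay; move: y ay x ax.
  apply: adjoin_ind => [k i Kk x ax|x y IHx IHy z az].
    exact: adjoin_addmonomial.
  by rewrite Algebra.addrA; apply/IHy/IHx.
split=> //; first by rewrite -[1](mulg1 1); exact: (adjoin_monomial a 0).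
move=> x y + ay; move: x; apply: adjoin_ind => [k i Kk|x z IHx IHz].
  move: y ay; apply: adjoin_ind => [l j Kl|y z IHy IHz].
    rewrite -mulgA (mulgA _ l) (zfmulC _ l) -mulgA -expgnDr mulgA.
    by apply: adjoin_monomial; exact: KM.
  by rewrite zfmulDr; exact: addK.
by rewrite zfmulDl; exact: addK.
Qed.

Lemma sub_adjoin a : K `<=` adjoin K a.
Proof. by move=> k Kk; rewrite -[k]mulg1; exact: (adjoin_monomial a 0). Qed.

Lemma adjoin_gen a : adjoin K a a.
Proof.
case: sK => K1 _ _; rewrite -[X in adjoin _ _ X]mul1g.
exact: (adjoin_monomial a 1).
Qed.

End Subsemiring.

Lemma adjoin_sub K V a :
  subsemiring V -> K `<=` V -> V a -> adjoin K a `<=` V.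
Proof.
move=> [V1 VD VM] KV Va; apply: adjoin_ind => [k i /KV Vk|]; last exact: VD.
by apply: (VM) => //; elim: i => [//|i IHi]; rewrite expgS; exact: VM.
Qed.

End Adjoin.

(** * Adjunction along the two axes of a layered domain *)

Section LayeredAdjoin.
Context (d d' : Order.disp_t) (L : sortingSemiringType d)
  (G : valueSemiringType d').
Implicit Types (A : set L) (B : set G) (s l : L) (v b : G).

Lemma layered_mulE l l' b b' :
  (l ⊙ b) * (l' ⊙ b') = (l * l') ⊙ (b * b') :> layered L G.
Proof. by []. Qed.

Lemma layered_add_same l l' b :
  (l ⊙ b) + (l' ⊙ b) = (l + l') ⊙ b :> layered L G.
Proof. by rewrite /Algebra.add /= /layered_add /= ltxx. Qed.

Lemma layered_expE l b i : (l ⊙ b) ^+ i = (l ^+ i) ⊙ (b ^+ i) :> layered L G.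
Proof. by elim: i => [//|i IHi]; rewrite !expgS IHi. Qed.

Lemma value_add_or b b' : b + b' = b \/ b + b' = b'.
Proof. by rewrite value_addE; case: leP; [right|left]. Qed.

Lemma layered_setP A B l b : layered_set A B (l ⊙ b) <-> A l /\ B b.
Proof.
by split=> [[k Ak [c Bc [<- <-]]]|[Al Bb]] //; exists l => //; exists b.
Qed.

Lemma layered_set_sub A A' B B' :
  A `<=` A' -> B `<=` B' -> layered_set A B `<=` layered_set A' B'.
Proof.
move=> AA' BB' _ [l Al [b Bb <-]].
by apply/layered_setP; split; [exact: AA'|exact: BB'].
Qed.

Lemma layered_set_subsemiring A B :
  subsemiring A -> subsemiring B -> subsemiring (layered_set A B).
Proof.
move=> [A1 AD AM] [B1 BD BM]; split; first exact/layered_setP.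
- move=> _ _ [l Al [b Bb <-]] [l' Al' [b' Bb' <-]].
  rewrite /Algebra.add /= /layered_add /=.
  by case: ltgtP => _; apply/layered_setP; split=> //; exact: AD.
- move=> _ _ [l Al [b Bb <-]] [l' Al' [b' Bb' <-]].
  by apply/layered_setP; split; [exact: AM|exact: BM].
Qed.

(** Elements of the same value add like their layers, so that a polynomial
    expression in [s] can be evaluated inside a single value. *)
Lemma adjoin_sorting A B s : subsemiring A -> subsemiring B ->
  adjoin (layered_set A B) (s ⊙ 1) = layered_set (adjoin A s) B.
Proof.
move=> sA sB; have sAB := layered_set_subsemiring sA sB.
have [_ addS _] := adjoin_subsemiring sAB (s ⊙ 1).
apply/seteqP; split.
  apply: adjoin_sub.
  - by apply: layered_set_subsemiring => //; exact: adjoin_subsemiring.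
  - by apply: layered_set_sub => //; exact: sub_adjoin.
  - by apply/layered_setP; split; [exact: adjoin_gen | case: sB].
move=> _ [l Al [b Bb <-]]; move: l Al; apply: adjoin_ind => [k i Ak|k l IHk IHl].
  rewrite -[b]mulg1 -[X in _ ⊙ (_ * X)](expg1n _ i) -layered_mulE -layered_expE.
  by apply: adjoin_monomial; apply/layered_setP.
by rewrite -layered_add_same; exact: addS.
Qed.

(** A sum of values is one of them, so that every element of [B[v]] is already
    obtained without adding, hence without disturbing the layer. *)
Lemma adjoin_value A B v : subsemiring A -> subsemiring B ->
  adjoin (layered_set A B) (1 ⊙ v) = layered_set A (adjoin B v).
Proof.
move=> sA sB; apply/seteqP; split.
  apply: adjoin_sub.
  - by apply: layered_set_subsemiring => //; exact: adjoin_subsemiring.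
  - by apply: layered_set_sub => //; exact: sub_adjoin.
  - by apply/layered_setP; split; [case: sA | exact: adjoin_gen].
move=> _ [l Al [b Bb <-]]; move: b Bb; apply: adjoin_ind => [c i Bc|b c IHb IHc].
  rewrite -[l]mulg1 -[X in (_ * X) ⊙ _](expg1n _ i) -layered_mulE -layered_expE.
  by apply: adjoin_monomial; apply/layered_setP.
by have [->|->] := value_add_or b c.
Qed.

Lemma image_value A B : A 1 -> [set value x | x in layered_set A B] = B.
Proof.
move=> A1; apply/seteqP; split=> [_ [_ [l _ [b Bb <-]] <-] //|b Bb].
by exists (1 ⊙ b) => //; apply/layered_setP.
Qed.

(** A uniform domain is a subsemiring, so that it contains [H[a]] as soon as it
    contains [H] and [a]: the closure of [H[a]] and the least extension of [H]
    containing [a] are minimal for the same property. *)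
Lemma uniform_sub_adjoin (H V : set (layered L G)) a :
    subsemiring H -> uniform_subdomain V ->
  adjoin H a `<=` V <-> H `<=` V /\ V a.
Proof.
move=> sH [A [B [sA sB ->]]]; split=> [HaV|[HV Va]].
  by split=> [x /(sub_adjoin a) /HaV //|]; exact/HaV/adjoin_gen.
by apply: adjoin_sub => //; exact: layered_set_subsemiring.
Qed.

Lemma least_extension (LH : set L) (GH : set G) a :
    subsemiring LH -> subsemiring GH ->
  least [set V | [/\ uniform_subdomain V, layered_set LH GH `<=` V & V a]]
    (layered_set (adjoin LH (sorting a)) (adjoin GH (value a))).
Proof.
case: a => s v sL sG /=; have [L1 _ _] := sL; have [G1 _ _] := sG.
split=> [|_ [[A [B [sA sB ->]]] HV /layered_setP[As Bv]]].
  split.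
  - exists (adjoin LH s), (adjoin GH v).
    by split=> //; exact: adjoin_subsemiring.
  - by apply: layered_set_sub; exact: sub_adjoin.
  - by apply/layered_setP; split; exact: adjoin_gen.
apply: layered_set_sub; apply: adjoin_sub => //.
- move=> l Ll.
  by have /HV/layered_setP[] : layered_set LH GH (l ⊙ 1) by apply/layered_setP.
- move=> b Gb.
  by have /HV/layered_setP[] : layered_set LH GH (1 ⊙ b) by apply/layered_setP.
Qed.

End LayeredAdjoin.

Theorem proposition5p25 (d d' : Order.disp_t) (L : sortingSemiringType d)
    (G : valueSemiringType d') (LH : set L) (GH : set G) (a : layered L G) :
  let H := layered_set LH GH in
  let sa := sorting a ⊙ 1 in
  let va := 1 ⊙ value a in
  uniform_semifield LH GH ->
  exists U : set (layered L G),
    is_uniform_closure (adjoin H a) U /\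
    U = adjoin (adjoin H sa) va /\
    U = adjoin (adjoin H va) sa /\
    U = [set x * y | x in adjoin H sa & y in adjoin H va] /\
    U = [set z | exists p q alpha s,
          [/\ zfpoly_over LH p, zfpoly_over H q, GH alpha, LH s
            & z = (peval p (sorting a) ⊙ alpha) * (s ⊙ value (peval q va))]] /\
    U = layered_set (adjoin LH (sorting a)) [set value x | x in adjoin H va] /\
    least [set V | [/\ uniform_subdomain V, H `<=` V & V a]] U.
Proof.
move: a => [s v] H sa va [sL sG _] /=.
have [L1 _ LM] := sL; have [G1 _ GM] := sG.
have sLs := adjoin_subsemiring sL s; have sGv := adjoin_subsemiring sG v.
have sH : subsemiring H by exact: layered_set_subsemiring.
have Hsa : adjoin H sa = layered_set (adjoin LH s) GH by exact: adjoin_sorting.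
have Hva : adjoin H va = layered_set LH (adjoin GH v) by exact: adjoin_value.
have valueHva : [set value x | x in adjoin H va] = adjoin GH v.
  by rewrite Hva image_value.
have leastU := least_extension (s ⊙ v) sL sG; rewrite /= -/H in leastU.
have [[uU HU Ua] minU] := leastU.
exists (layered_set (adjoin LH s) (adjoin GH v)); split.
  split=> [|V [uV /(uniform_sub_adjoin _ sH uV)[HV Va]]].
    by split=> //; apply/uniform_sub_adjoin.
  exact: minU.
split; first by rewrite Hsa adjoin_value.
split; first by rewrite Hva adjoin_sorting.
have LsM l k : adjoin LH s l -> LH k -> adjoin LH s (l * k).
  by case: sLs => _ _ mulS ? ?; apply: mulS => //; exact: sub_adjoin.
have GvM c b : GH c -> adjoin GH v b -> adjoin GH v (c * b).
  by case: sGv => _ _ mulG ? ?; apply: mulG => //; exact: sub_adjoin.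
split.
  rewrite Hsa Hva; apply/seteqP; split=> [_ [l Ll [b Gb <-]]|].
    exists (l ⊙ 1); first by apply/layered_setP.
    exists (1 ⊙ b); first by apply/layered_setP.
    by rewrite layered_mulE mulg1 mul1g.
  move=> _ [_ [l Ll [c Gc <-]]] [_ [k Lk [b Gb <-]] <-].
  by apply/layered_setP; split; [exact: LsM|exact: GvM].
split; last by rewrite valueHva.
apply/seteqP; split=> [_ [_ [p Lp <-] [b Gb <-]]|].
  move: Gb; rewrite -valueHva => -[_ [q Hq <-] <-].
  by exists p, q, 1, 1; split=> //; rewrite layered_mulE mulg1 mul1g.
move=> _ [p [q [c [k [Lp Hq Gc Lk ->]]]]].
apply/layered_setP; split; first by apply: LsM => //; exists p.
by apply: GvM => //; rewrite -valueHva; exists (peval q va) => //; exists q.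
Qed.
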